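(* For every integer $t \geq 1$ there exists an integer $c_t$ such that every matroid $M=(E,G)$ that is $I_{1,t}$-free and triangle-free satisfies $\chi(M) \leq c_t$.
   Context: A (simple binary) matroid is a pair $M=(E,G)$ where $G$ is a finite binary projective geometry $\mathrm{PG}(n-1,2)$ (identified with the set of nonzero vectors of $\mathrm{GF}(2)^n$) and $E$ is an arbitrary subset of the points of $G$ (not required to span $G$); $n$ is the dimension of $M$. A flat of $G$ is a subgeometry (the nonzero vectors of a linear subspace), with dimension that of the subspace. Two matroids $(E_1,G_1)$, $(E_2,G_2)$ are isomorphic if some isomorphism $G_1\to G_2$ maps $E_1$ onto $E_2$. An induced restriction of $M$ is a matroid $(E\cap F, F)$ for a flat $F$ of $G$; $M$ is $N$-free if no induced restriction of $M$ is isomorphic to $N$. $I_{1,t}$ denotes the matroid $(E,G)$ with $G$ of dimension $t$ and $|E|=1$; thus $M$ is $I_{1,t}$-free iff no $t$-dimensional flat $F$ of $G$ has $|E\cap F|=1$. A triangle is a $2$-dimensional flat of $G$; $M$ is triangle-free if $E$ contains no triangle. For a matroid $N=(E',G')$, $\omega(N)$ is the largest dimension of a flat of $G'$ contained in $E'$. The complement of $M$ is $M^c=(G\setminus E, G)$, and the critical number is $\chi(M)= n-\omega(M^c)$, where $n$ is the dimension of $M$. *)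

(* Defs.v *)
From HB Require Import structures.
From mathcomp Require Import all_boot all_algebra.

Set Implicit Arguments.
Unset Strict Implicit.
Unset Printing Implicit Defensive.

Import GRing.Theory.
Local Open Scope ring_scope.

Section FiniteVspace.
Import VectorInternalTheory.
Variables (K : finFieldType) (vT : vectType K).
HB.instance Definition _ := [Countable of {vspace vT} by <:].
HB.instance Definition _ := [Finite of {vspace vT} by <:].
End FiniteVspace.

Notation GF2 m := ('rV['F_2]_m).

Definition points m (F : {vspace GF2 m}) : {set GF2 m} :=
  [set x in F | x != 0].

(* A projective geometry is represented by a subspace of some GF(2)^m, so that
   a flat F of G is again a geometry and (E :&: F, F) is literally a matroid.
   The dimension of the matroid is \dim of geometry, not the integer m. *)
Record matroid := Matroid {
  ambient : nat;
  geometry : {vspace GF2 ambient};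
  ground : {set GF2 ambient};
  ground_sub : ground \subset points geometry
}.

Definition dimension (M : matroid) : nat := \dim (geometry M).

Definition flat (M : matroid) (F : {vspace GF2 (ambient M)}) : bool :=
  (F <= geometry M)%VS.
Arguments flat : clear implicits.

Definition isomorphic (M N : matroid) : Prop :=
  exists f : 'Hom(GF2 (ambient M), GF2 (ambient N)),
    [/\ {in geometry M &, injective f},
        (f @: geometry M)%VS = geometry N
      & f @: ground M = ground N].

Lemma restriction_sub (M : matroid) (F : {vspace GF2 (ambient M)}) :
  ground M :&: points F \subset points F.
Proof. exact: subsetIr. Qed.

Definition restriction (M : matroid) (F : {vspace GF2 (ambient M)}) : matroid :=
  Matroid (restriction_sub F).
Arguments restriction : clear implicits.

Definition free_of (N M : matroid) : Prop :=
  forall F : {vspace GF2 (ambient M)}, flat M F -> ~ isomorphic (restriction M F) N.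

Lemma I1_sub t : [set const_mx 1 : GF2 t] :\ 0 \subset points {:GF2 t}.
Proof. by apply/subsetP => x; rewrite !inE memvf; case/andP=> ->. Qed.

(* I_{1,t}: the only point is the all-ones vector of GF(2)^t.  Removing 0 only
   matters for t = 0, where no one-point matroid exists. *)
Definition I1 (t : nat) : matroid := Matroid (@I1_sub t).

Definition triangle_free (M : matroid) : Prop :=
  forall F : {vspace GF2 (ambient M)},
    flat M F -> \dim F = 2%N -> ~~ (points F \subset ground M).

Definition omega (M : matroid) : nat :=
  \max_(F : {vspace GF2 (ambient M)} | flat M F && (points F \subset ground M))
    \dim F.

Lemma complement_sub (M : matroid) :
  points (geometry M) :\: ground M \subset points (geometry M).
Proof. exact: subsetDl. Qed.

Definition complement (M : matroid) : matroid := Matroid (complement_sub M).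

(* The truncated subtraction is harmless: omega (complement M) is the dimension
   of a flat of M, hence at most dimension M. *)
Definition critical_number (M : matroid) : nat :=
  (dimension M - omega (complement M))%N.

(* Main.v *)
(* If a flat U meets E in x, take W maximal among the subflats of U with
   E :&: W = {x}. Since M is I_{1,t}-free, dim W < t, and by maximality E meets
   every coset of W in U; hence E has density at least 2^-t in every flat that
   it meets. On the other hand E is sum-free. For C = E :&: U, expanding in
   characters gives sum_u S_u(E)^2 S_u(C) = 0, where S_u(X) is the character sum
   of u over X; the term u = 0 is positive, so some S_u(C) is at most
   -alpha |C|, alpha being the density of E. Passing from U to the hyperplane
   of u thus multiplies the density of E by at most 1 - alpha. After a number k
   of steps depending only on t the density would drop below 2^-t, so the flat
   reached, of codimension at most k, avoids E. *)
Require Import Defs.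
From mathcomp Require Import all_boot all_algebra.
From mathcomp Require Import order finfield ring zify.

Set Implicit Arguments.
Unset Strict Implicit.
Unset Printing Implicit Defensive.

Import Order.TTheory GRing.Theory Num.Theory.
Local Open Scope ring_scope.

(** * Linear algebra over GF(2): flats through a point and their isomorphisms *)

Lemma F2_eq1 (a : 'F_2) : a != 0 -> a = 1.
Proof. by case: a => [[|[|k]] lt_k] //= _; apply: val_inj. Qed.

Lemma rowF2_addxx m (x : GF2 m) : x + x = 0.
Proof. by apply/rowP => i; rewrite !mxE; apply: addrr_pchar2; apply: pchar_Fp. Qed.

Lemma rowF2_addKr m (x y : GF2 m) : x + (x + y) = y.
Proof. by rewrite addrA rowF2_addxx add0r. Qed.

Lemma card_flat m (U : {vspace GF2 m}) : #|[set x in U]| = (2 ^ \dim U)%N.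
Proof. by rewrite cardsE card_vspace card_Fp. Qed.

Lemma basis_through (K : fieldType) (V : vectType K) (U : {vspace V}) x :
  x \in U -> x != 0 ->
  exists2 b, size b = (\dim U).-1 & basis_of U (x :: b).
Proof.
move=> xU x0; exists (vbasis (U :\: <[x]>)).
  rewrite size_tuple -[in RHS](addv_diff_cap U <[x]>).
  rewrite (capv_idPr _) -?memvE //.
  by rewrite dimv_disjoint_sum ?capv_diff // dim_vline x0 addn1.
rewrite -[U in basis_of U](addv_diff_cap U <[x]>).
rewrite (capv_idPr _) -?memvE // addvC; apply: (@cat_basis _ _ _ _ [:: x]).
- by apply/directv_addP; rewrite capvC capv_diff.
- exact: seq1_basis.
- exact: vbasisP.
Qed.

Lemma subspace_through (K : fieldType) (V : vectType K) (U : {vspace V}) x t :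
  x \in U -> x != 0 -> (0 < t <= \dim U)%N ->
  exists F : {vspace V}, [/\ x \in F, (F <= U)%VS & \dim F = t].
Proof.
move=> xU x0 /andP[t0 tU]; have [b sb bU] := basis_through xU x0.
have spU := span_basis bU; have := basis_free bU.
rewrite -[b](cat_take_drop t.-1) -cat_cons cat_free => /andP[frF _].
exists <<x :: take t.-1 b>>%VS; split.
- by rewrite memv_span ?mem_head.
- rewrite -spU; apply: sub_span => z; rewrite !inE.
  by case/orP=> [-> // | /mem_take ->]; rewrite orbT.
- by rewrite (eqnP frF) /= size_takel ?prednK // sb -!subn1 leq_sub2r.
Qed.

(** Match a basis of [U] through [x] with a basis of [U'] through [y]. Prescribing the image of [x]
    lets a one-point restriction be identified with [I1 t]. *)
Lemma flat_iso (K : fieldType) (V W : vectType K) (U : {vspace V})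
    (U' : {vspace W}) (x : V) (y : W) :
  \dim U = \dim U' -> x \in U -> x != 0 -> y \in U' -> y != 0 ->
  exists f : 'Hom(V, W), [/\ {in U &, injective f}, (f @: U)%VS = U' & f x = y].
Proof.
move=> dimU xU x0 yU y0.
have [b sb bU] := basis_through xU x0.
have [c sc cU] := basis_through yU y0.
have [f fP] := linear_of_free (x :: b) (y :: c).
have /(_ (basis_free bU)) := fP.
rewrite /= sb sc dimU => /(_ erefl)[fx fb].
have fU : (linfun f @: U)%VS = U'.
  rewrite -(span_basis bU) limg_span /= lfunE fx.
  rewrite (eq_map (g := f)) ?fb ?(span_basis cU) // => z.
  by rewrite lfunE.
exists (linfun f); split; rewrite ?lfunE //.
have := limg_ker_dim (linfun f) U; rewrite fU dimU => /eqP.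
rewrite -[X in _ == X]add0n eqn_add2r dimv_eq0 => /eqP ker0 u v uU vU fuv.
apply/eqP; rewrite -subr_eq0 -memv0 -ker0 memv_cap rpredB //=.
by rewrite memv_ker linearB /= fuv subrr.
Qed.

(** * What the two hypotheses on [M] say about its points: sum-freeness and density *)

Lemma triangle_free_addN (M : matroid) x y : triangle_free M ->
  x \in ground M -> y \in ground M -> x + y \notin ground M.
Proof.
move=> tf xE yE; apply/negP => xyE.
have inG z : z \in ground M -> z \in geometry M /\ z != 0.
  by move/(subsetP (ground_sub M)); rewrite inE => /andP.
have [xG x0] := inG _ xE; have [yG y0] := inG _ yE; have [_ xy0] := inG _ xyE.
(* The span of [x] and [y] is the forbidden triangle; [x = y] cannot occur here, because [x + y],
   being a point, is nonzero. *)
have fl : flat M (<[x]> + <[y]>)%VS by rewrite /flat subv_add -!memvE xG yG.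
have dim2 : \dim (<[x]> + <[y]>) = 2%N.
  rewrite dimv_disjoint_sum ?dim_vline ?x0 ?y0 //.
  apply/eqP; rewrite -subv0; apply/subvP => z; rewrite memv_cap memv0.
  case/andP=> /vlineP[a ->] /vlineP[b].
  have [->|/F2_eq1 ->] := eqVneq a 0; first by rewrite scale0r.
  have [->|/F2_eq1 ->] := eqVneq b 0; first by rewrite scale0r => ->.
  by rewrite !scale1r => xy; rewrite xy rowF2_addxx eqxx in xy0.
move/negP: (tf _ fl dim2); apply.
apply/subsetP => z; rewrite inE => /andP[/memv_addP[_ /vlineP[a ->]]].
case=> _ /vlineP[b ->] ->.
have [->|/F2_eq1 ->] := eqVneq a 0; have [->|/F2_eq1 ->] := eqVneq b 0.
all: by rewrite ?scale0r ?scale1r ?add0r ?addr0 ?eqxx.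
Qed.

(** Otherwise some [t]-dimensional subflat of [W] through [x] would again meet the ground set in [x]
    only, giving a copy of [I1 t]. *)
Lemma unique_point_dim (M : matroid) t (W : {vspace GF2 (ambient M)}) x :
  (0 < t)%N -> free_of (I1 t) M -> flat M W ->
  ground M :&: [set z in W] = [set x] -> (\dim W < t)%N.
Proof.
move=> t0 fr WG EW; rewrite ltnNge; apply/negP => tW.
have /setP/(_ x) := EW; rewrite !inE eqxx => /andP[xE xW].
have x0 : x != 0.
  by move/(subsetP (ground_sub M)): xE; rewrite inE => /andP[].
have [F [xF FW dF]] : exists F : {vspace GF2 (ambient M)},
    [/\ x \in F, (F <= W)%VS & \dim F = t].
  by apply: (subspace_through xW x0); rewrite t0.
pose j : GF2 t := const_mx 1.
have j0 : j != 0.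
  by apply/eqP => /rowP/(_ (Ordinal t0)); rewrite !mxE; apply/eqP/oner_neq0.
have dF' : \dim F = \dim {:GF2 t} by rewrite dF dimvf /dim /= mul1n.
have [f [injf fF fx]] := flat_iso dF' xF x0 (memvf j) j0.
apply: (fr F); first exact: subv_trans FW WG.
exists f; split => //=.
have -> : ground M :&: points F = [set x].
  apply/setP => z; rewrite !inE; have /setP/(_ z) := EW; rewrite !inE => EWz.
  apply/idP/idP => [/and3P[zE zF z0]|/eqP->]; last by rewrite xE xF x0.
  by rewrite -EWz zE (subvP FW).
rewrite imset_set1 fx; apply/setP => z; rewrite !inE andbC.
by have [->|] := eqVneq z j; rewrite ?j0.
Qed.

(** * Characters of GF(2)^d and the density decrement *)

Definition sgF2 (a : 'F_2) : int := if a == 0 then 1 else -1.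

Lemma sgF2D a b : sgF2 (a + b) = sgF2 a * sgF2 b.
Proof.
by case: a b => [[|[|a]] ?] [[|[|b]] ?].
Qed.

Lemma flat_dense (M : matroid) t (U : {vspace GF2 (ambient M)}) :
  (0 < t)%N -> free_of (I1 t) M -> flat M U ->
  ground M :&: [set z in U] != set0 ->
  (2 ^ \dim U <= 2 ^ t * #|ground M :&: [set z in U]|)%N.
Proof.
move=> t0 fr UG /set0Pn[x /setIP[xE]]; rewrite inE => xU.
pose P (W : {vspace GF2 (ambient M)}) :=
  (W <= U)%VS && (ground M :&: [set z in W] == [set x]).
have P0 : P <[x]>%VS.
  rewrite /P -memvE xU; apply/eqP/setP => z; rewrite !inE.
  apply/andP/eqP => [[zE /vlineP[a za]]|->]; last by rewrite memv_line.
  have [a0|/F2_eq1 a1] := eqVneq a 0; last by rewrite za a1 scale1r.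
  have := subsetP (ground_sub M) _ zE.
  by rewrite inE za a0 scale0r eqxx andbF.
case: (arg_maxnP (fun W : {vspace GF2 (ambient M)} => \dim W) P0).
move=> W /andP[WU /eqP EW] maxW.
have dW : (\dim W < t)%N.
  by apply: unique_point_dim t0 fr _ EW; apply: subv_trans WU UG.
have cover u : u \in U -> exists2 w, w \in W & u + w \in ground M.
  move=> uU; have [uW|uNW] := boolP (u \in W).
    have /setP/(_ x) := EW; rewrite !inE eqxx => /andP[_ xW].
    by exists (u + x); rewrite ?rpredD // rowF2_addKr.
  have [/existsP[w /andP[]]|none] := boolP [exists w, (w \in W) && (u + w \in ground M)].
    by exists w.
  (* [W + <[u]>] consists of [W] and the coset of [u]. If that coset misses the ground set, the
     larger flat still satisfies [P], against maximality. *)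
  have /maxW : P (W + <[u]>)%VS.
    rewrite /P subv_add WU -memvE uU /= -EW; apply/eqP/setP => z; rewrite !inE.
    apply: andb_id2l => zE; apply/idP/idP => [|zW]; last first.
      exact: subvP (addvSl _ _) _ zW.
    case/memv_addP=> w wW [_ /vlineP[a ->] zw].
    have [a0|/F2_eq1 a1] := eqVneq a 0; first by rewrite zw a0 scale0r addr0.
    case/negP: none; apply/existsP; exists w; rewrite wW /=.
    by rewrite addrC -[u]scale1r -a1 -zw.
  rewrite /= (geq_leqif (dimv_leqif_sup _)) ?addvSl // subv_add subvv /=.
  by rewrite -memvE (negPf uNW).
(* Every vector of [U] is a point of the ground set in [U] plus a vector of [W], so the product of
   the two cardinalities bounds that of [U]. *)
have : [set z in U] \subset
    [set p.1 + p.2 | p in setX (ground M :&: [set z in U]) [set z in W]].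
  apply/subsetP => u; rewrite inE => uU; have [w wW uwE] := cover u uU.
  apply/imsetP; exists (u + w, w); last by rewrite /= -addrA rowF2_addxx addr0.
  by rewrite !inE uwE wW andbT /= rpredD // (subvP WU).
move/subset_leq_card/leq_trans/(_ (leq_imset_card _ _)).
rewrite cardsX !card_flat mulnC => /leq_trans; apply.
by rewrite leq_mul2r leq_exp2l // ltnW ?orbT.
Qed.

Definition dotF2 d (u v : GF2 d) : 'F_2 := (u *m v^T) 0 0.

Lemma dotF2Dl d (u u' v : GF2 d) : dotF2 (u + u') v = dotF2 u v + dotF2 u' v.
Proof. by rewrite /dotF2 mulmxDl mxE. Qed.

Lemma dotF2Dr d (u v v' : GF2 d) : dotF2 u (v + v') = dotF2 u v + dotF2 u v'.
Proof. by rewrite /dotF2 linearD mulmxDr mxE. Qed.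

Lemma sum_characters d (v : GF2 d) :
  \sum_u sgF2 (dotF2 u v) = if v == 0 then (2 ^ d)%N%:Z else 0.
Proof.
have [->|v0] := eqVneq v 0.
  rewrite (eq_bigr (fun=> 1)) => [|u _]; last first.
    by rewrite /dotF2 linear0 mulmx0 mxE.
  by rewrite sumr_const card_mx card_Fp // mul1n natz.
have [i /F2_eq1 vi] : exists i, v 0 i != 0.
  apply/existsP; apply: contra_neqT v0; rewrite negb_exists => /forallP v0.
  by apply/rowP => i; have := v0 i; rewrite negbK mxE => /eqP.
set s := \sum_u _; suff : s = - s by lia.
(* Translating [u] by the unit vector at a nonzero coordinate of [v] flips every sign. *)
rewrite {1}/s (reindex_inj (addrI (delta_mx 0 i))) -sumrN.
apply: eq_bigr => u _; rewrite dotF2Dl sgF2D /dotF2 -rowE !mxE vi.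
by rewrite /sgF2 oner_eq0 mulN1r.
Qed.

Definition charsum d (u : GF2 d) (X : {set GF2 d}) : int :=
  \sum_(x in X) sgF2 (dotF2 u x).

(** Turns a negative character sum into a small count on the kernel of [u]. *)
Lemma charsumE d (u : GF2 d) (X : {set GF2 d}) :
  charsum u X = 2 * #|[set x in X | dotF2 u x == 0]|%:Z - #|X|%:Z.
Proof.
set H := [set x | dotF2 u x == 0].
have -> : [set x in X | dotF2 u x == 0] = X :&: H.
  by apply/setP => x; rewrite !inE.
rewrite /charsum (big_setID H) -(cardsID H X) /=.
rewrite (eq_bigr (fun=> 1)) => [|x]; last by rewrite !inE /sgF2 => /andP[_ ->].
rewrite [Z in _ + Z](eq_bigr (fun=> -1)) => [|x]; last first.
  by rewrite !inE /sgF2 => /andP[/negPf-> _].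
rewrite sumrN !sumr_const !natz PoszD; ring.
Qed.

(** Parseval: by orthogonality only the pairs with [a = b] contribute. *)
Lemma sum_charsum_sqr d (A : {set GF2 d}) :
  \sum_u charsum u A ^+ 2 = (2 ^ d)%N%:Z * #|A|%:Z.
Proof.
pose F u a b := sgF2 (@dotF2 d u (a + b)).
have -> : \sum_u charsum u A ^+ 2 = \sum_u \sum_(a in A) \sum_(b in A) F u a b.
  apply: eq_bigr => u _; rewrite expr2 big_distrlr /=.
  by apply: eq_bigr => a _; apply: eq_bigr => b _; rewrite /F dotF2Dr sgF2D.
rewrite exchange_big /= (eq_bigr (fun=> (2 ^ d)%N%:Z)) => [|a aA].
  by rewrite sumr_const -mulr_natr natz.
rewrite exchange_big /= (bigD1 a) //= sum_characters rowF2_addxx eqxx.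
rewrite big1 ?addr0 // => b /andP[_ ba]; rewrite sum_characters.
case: eqP => // ab0; case/eqP: ba.
by rewrite -(rowF2_addKr a b) ab0 addr0.
Qed.

(** By orthogonality the sum is 2^d times the number of solutions of [a + b = c]. *)
Lemma sum_charsum_sumfree d (A C : {set GF2 d}) :
  {in A &, forall a b, a + b \notin C} ->
  \sum_u charsum u A ^+ 2 * charsum u C = 0.
Proof.
move=> sumfree; pose F u a b c := sgF2 (@dotF2 d u (a + b + c)).
have -> : \sum_u charsum u A ^+ 2 * charsum u C =
    \sum_u \sum_(a in A) \sum_(b in A) \sum_(c in C) F u a b c.
  apply: eq_bigr => u _; rewrite expr2 -mulrA big_distrl /=.
  apply: eq_bigr => a _; rewrite big_distrlr big_distrr /=.
  apply: eq_bigr => b _; rewrite big_distrr /=.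
  by apply: eq_bigr => c _; rewrite /F !dotF2Dr !sgF2D mulrA.
rewrite exchange_big big1 //= => a aA; rewrite exchange_big big1 //= => b bA.
rewrite exchange_big big1 //= => c cC; rewrite sum_characters.
case: eqP => // abc; have /negP[] := sumfree a b aA bA.
by rewrite -(rowF2_addKr c (a + b)) [c + (a + b)]addrC abc addr0.
Qed.

(** With alpha the density of [A], the kernel of [u] contains at most (1 - alpha)/2 of [C]. In
    particular [u = 0] is possible only for empty [C]. *)
Lemma exists_sparse_hyperplane d (A C : {set GF2 d}) :
  A != set0 -> {in A &, forall a b, a + b \notin C} ->
  exists u, (2 * 2 ^ d * #|[set c in C | dotF2 u c == 0%R]| + #|A| * #|C|
             <= 2 ^ d * #|C|)%N.
Proof.
rewrite -card_gt0 => A0 sumfree.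
(* With weights S_u(A)^2, the positive quantities g u would average to
   #|A| * #|C|, which the term u = 0 alone exceeds. *)
set N := (2 ^ d)%N; set al := #|A|; set ga := #|C|.
pose g u := N%:Z * charsum u C + (al * ga)%N%:Z.
have [/existsP[u gu]|] := boolP [exists u, g u <= 0].
  by exists u; move: gu; rewrite /g charsumE -/ga; nia.
rewrite negb_exists => /forallP gpos.
have g0 u : 0 < g u by have := gpos u; lia.
have sum_g : \sum_u charsum u A ^+ 2 * g u = (al * ga)%N%:Z * (N%:Z * al%:Z).
  transitivity (N%:Z * (\sum_u charsum u A ^+ 2 * charsum u C) +
                (al * ga)%N%:Z * (\sum_u charsum u A ^+ 2)).
    by rewrite !mulr_sumr -big_split; apply: eq_bigr => u _ /=; rewrite /g; ring.
  by rewrite sum_charsum_sumfree // mulr0 add0r sum_charsum_sqr.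
have S0 (X : {set GF2 d}) : charsum 0 X = #|X|%:Z.
  rewrite /charsum (eq_bigr (fun=> 1)) ?sumr_const ?natz // => x _.
  by rewrite /dotF2 mul0mx mxE.
have : charsum 0 A ^+ 2 * g 0 <= \sum_u charsum u A ^+ 2 * g u.
  rewrite (bigD1 0) //= lerDl; apply: sumr_ge0 => u _.
  by rewrite mulr_ge0 ?sqr_ge0 // ltW.
(* The term at 0 is al^2 (N ga + al ga) and the total is al^2 N ga, so al^3 ga <= 0; but [g 0 > 0]
   forces [ga > 0]. *)
have := g0 0; rewrite sum_g /g !S0 -/al -/ga => Cpos.
have ga0 : (0 < ga)%N by nia.
have : (0 < al * al * al * ga)%N by rewrite !muln_gt0 A0 ga0.
rewrite expr2 !PoszM; nia.
Qed.

Lemma exists_sparse_subflat (M : matroid) q (U : {vspace GF2 (ambient M)}) :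
  triangle_free M -> ground M != set0 -> flat M U ->
  (2 ^ dimension M <= q * #|ground M|)%N ->
  exists U' : {vspace GF2 (ambient M)},
    [/\ (U' <= U)%VS, (\dim U <= (\dim U').+1)%N &
        (2 * q * #|ground M :&: [set z in U']|
           <= q.-1 * #|ground M :&: [set z in U]|)%N].
Proof.
move=> tf E0 UG dense.
have inG z : z \in ground M -> z \in geometry M /\ z != 0.
  by move/(subsetP (ground_sub M)); rewrite inE => /andP.
have /set0Pn[x /inG[xG x0]] := E0.
set d := dimension M in dense *.
have d0 : (0 < d)%N.
  by have := dimvS (xG : (<[x]> <= _)%VS); rewrite dim_vline x0.
pose j : GF2 d := const_mx 1.
have j0 : j != 0.
  by apply/eqP => /rowP/(_ (Ordinal d0)); rewrite !mxE; apply/eqP/oner_neq0.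
have dG : \dim (geometry M) = \dim {:GF2 d} by rewrite dimvf /dim /= mul1n.
(* [f] gives coordinates on the geometry, so that 2^d counts the vectors of the geometry and not
   those of the ambient space. *)
have [f [injf _ _]] := flat_iso dG xG x0 (memvf j) j0.
have injE (B : {set GF2 (ambient M)}) : #|f @: (ground M :&: B)| = #|ground M :&: B|.
  apply: card_in_imset => y z /setIP[/inG[yG _] _] /setIP[/inG[zG _] _].
  exact: injf.
(* [A] is the whole ground set and only [C] is cut down to [U], so the same factor 1 - 1/q is
   available at every step. *)
have [||u Hu] := @exists_sparse_hyperplane d (f @: (ground M :&: setT))
  (f @: (ground M :&: [set z in U])).
- by rewrite setIT imset_eq0.
- move=> _ _ /imsetP[y /setIP[yE _] ->] /imsetP[z /setIP[zE _] ->].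
  apply/imsetP => -[w /setIP[wE _]]; rewrite -linearD => /= fyz.
  have := triangle_free_addN tf yE zE; rewrite (injf _ _ _ _ fyz) ?wE //.
  - by rewrite rpredD //; case: (inG _ yE); case: (inG _ zE).
  - by case: (inG _ wE).
(* The character [u] pulled back along [f] as a linear form; its kernel cuts [U] in [U] itself or in
   a hyperplane. *)
pose g : 'Hom(GF2 (ambient M), 'rV['F_2]_1) := (linfun (mulmxr u^T) \o f)%VF.
have gE z : (z \in lker g) = (dotF2 u (f z) == 0).
  rewrite memv_ker comp_lfunE lfunE /= /dotF2 -[f z *m _]trmxK trmx_mul trmxK.
  rewrite trmx_eq0; apply/eqP/eqP => [->|uz]; first by rewrite mxE.
  by apply/matrixP => i k; rewrite !ord1 uz mxE.
exists (U :&: lker g)%VS; split; first exact: capvSl.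
  have g1 : (\dim (g @: U) <= 1)%N by rewrite (leq_trans (dimvS (subvf _))) ?dimvf.
  by rewrite -(limg_ker_dim g U) addnC; apply: (leq_add g1 (leqnn _)).
have EU' : [set c in f @: (ground M :&: [set z in U]) | dotF2 u c == 0] =
    f @: (ground M :&: [set z in (U :&: lker g)%VS]).
  apply/setP => c; rewrite !inE; apply/andP/imsetP => [[]|[z]].
    case/imsetP=> z; rewrite !inE => /andP[zE zU] -> uz.
    by exists z; rewrite // !inE zE memv_cap zU gE.
  rewrite !inE memv_cap gE => /and3P[zE zU uz] ->; split=> //.
  by apply: imset_f; rewrite !inE zE.
move: Hu; rewrite EU' !injE setIT.
set e := #|ground M|; set a := #|_ :&: _|; set c := #|_ :&: _|.
set N := (2 ^ d)%N in dense *.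
have N0 : (0 < N)%N by rewrite expn_gt0.
have q0 : (0 < q)%N by case: (q) dense; lia.
move=> Hu; rewrite -(leq_pmul2l N0).
have : (N * c <= q * (e * c))%N by rewrite mulnA leq_mul2r dense orbT.
have : (q * (2 * N * a) + q * (e * c) <= q * (N * c))%N.
  by rewrite -mulnDr leq_mul2l Hu orbT.
rewrite -subn1 mulnBl mulnBr mul1n; nia.
Qed.

(** * The number of steps, and the final bound *)

Lemma bernoulli p k : (p ^ k.+1 + k.+1 * p ^ k <= p.+1 ^ k.+1)%N.
Proof.
elim: k => [|k IH]; first by rewrite !expn1 expn0; lia.
rewrite [(p.+1 ^ _)%N]expnS (leq_trans _ (leq_mul (leqnn p.+1) IH)) //.
rewrite [(p ^ k.+2)%N]expnS expnS; nia.
Qed.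

Lemma exists_expn_gt q : (0 < q)%N -> exists k, (q * q.-1 ^ k < q ^ k)%N.
Proof.
(* With q = p + 1 and s = p^(p^2), Bernoulli gives q^k >= s (p^2 + p + 1), while q p^k = s (p^2 +
   p). *)
case: q => // p _; exists (p ^ 2).+1.
apply: leq_trans (bernoulli p _); rewrite /= expnS.
case: p => [|p]; first by [].
have : (0 < p.+1 ^ (p.+1 ^ 2))%N by rewrite expn_gt0.
set s := (_ ^ _)%N; nia.
Qed.

Theorem theorem1p3 :
  forall t : nat, (1 <= t)%N ->
  exists c : nat, forall M : matroid,
    free_of (I1 t) M -> triangle_free M -> (critical_number M <= c)%N.
Proof.
move=> t t0; have [|k hk] := @exists_expn_gt (2 ^ t); first by rewrite expn_gt0.
exists k => M fr tf; set q := (2 ^ t)%N in hk.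
have avoid U : flat M U -> ground M :&: [set z in U] = set0 ->
    (dimension M <= \dim U + k)%N -> (critical_number M <= k)%N.
  move=> UG EU dimU; rewrite /critical_number leq_subLR addnC.
  apply: leq_trans dimU _; rewrite addnC leq_add2l /omega.
  apply: (@leq_bigmax_cond _ _ (fun F : {vspace GF2 _} => \dim F) U).
  rewrite /flat (UG : (U <= geometry M)%VS) /=.
  apply/subsetP => z; rewrite !inE => /andP[zU z0].
  by have /setP/(_ z) := EU; rewrite !inE zU z0 (subvP UG) // andbT => ->.
have EG : ground M :&: [set z in geometry M] = ground M.
  apply/setIidPl/subsetP => z /(subsetP (ground_sub M)).
  by rewrite !inE => /andP[].
have [E0|E0] := eqVneq (ground M) set0.
  by apply: (avoid (geometry M)); rewrite /flat ?E0 ?set0I ?leq_addr.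
have dense : (2 ^ dimension M <= q * #|ground M|)%N.
  by rewrite -EG; apply: flat_dense; rewrite ?EG /flat.
(* Iterating the decrement [k] times from the full geometry. The powers of 2 account for the halving
   of the flat, so the density falls by (1 - 1/q)^k. *)
have [U [UG dimU sparse]] : exists U : {vspace GF2 (ambient M)},
    [/\ flat M U, (dimension M <= \dim U + k)%N &
     ((2 * q) ^ k * #|ground M :&: [set z in U]|
        <= q.-1 ^ k * 2 ^ dimension M)%N].
  elim: (k) => [|i [U [UG dimU sparse]]].
    exists (geometry M); rewrite /flat subvv addn0 EG !mul1n; split => //.
    rewrite -card_flat subset_leq_card //; apply/subsetP => z.
    by move/(subsetP (ground_sub M)); rewrite !inE => /andP[].
  have [U' [U'U dimU' sparse']] := exists_sparse_subflat tf E0 UG dense.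
  exists U'; split; first exact: subv_trans U'U UG.
    by rewrite (leq_trans dimU) // addnS -addSn leq_add2r.
  have := leq_mul (leqnn ((2 * q) ^ i)) sparse'.
  have := leq_mul (leqnn q.-1) sparse.
  rewrite !expnS; nia.
have [EU|EU] := eqVneq (ground M :&: [set z in U]) set0; first exact: avoid EU dimU.
have := flat_dense t0 fr UG EU; rewrite -/q => denseU.
have : (2 ^ dimension M <= 2 ^ \dim U * 2 ^ k)%N by rewrite -expnD leq_exp2l.
have : (0 < #|ground M :&: [set z in U]|)%N by rewrite card_gt0.
move: sparse denseU hk; rewrite expnMn.
set e := #|_|; set A := (q ^ k)%N; set B := (q.-1 ^ k)%N; set K := (2 ^ k)%N.
set G := (2 ^ dimension M)%N; set u := (2 ^ _)%N => sparse denseU hk e0 hG.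
have K0 : (0 < K)%N by rewrite expn_gt0.
(* Chain K A e <= B G <= B u K <= B q e K; cancelling [K * e] contradicts the choice of [k]. *)
have : (K * e * A <= K * e * (q * B))%N.
  have H1 : (B * G <= B * (u * K))%N by rewrite leq_mul2l hG orbT.
  have H2 : (B * (u * K) <= B * (q * e * K))%N.
    by rewrite !leq_mul2l leq_mul2r denseU !orbT.
  nia.
by rewrite leq_pmul2l ?muln_gt0 ?K0 // leqNgt hk.
Qed.
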